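(* Let $\mathbb{F}\in\{\mathbb{R},\mathbb{C},\mathbb{H}\}$ and let $\Phi:\mathbb{F}^2\to\mathcal{H}_2^0(\mathbb{F})$ be the Hopf map. Then: (1) $\Phi$ is surjective. (2) For each $(\lambda,\alpha)\in\mathbb{R}\oplus\mathbb{F}$: if $(\lambda,\alpha)\neq(0,0)$ then $$\Phi^{-1}\left(\begin{pmatrix}\lambda&\alpha\\ \overline{\alpha}&-\lambda\end{pmatrix}\right)\simeq\mathbb{F}(1)\quad\text{(homeomorphic)},$$ and if $(\lambda,\alpha)=(0,0)$ then $$\Phi^{-1}\left(\begin{pmatrix}0&0\\ 0&0\end{pmatrix}\right)=\left\{\begin{pmatrix}0\\ 0\end{pmatrix}\right\}.$$
   Context: $\mathcal{H}_2^0(\mathbb{F})$ is the real vector space of $2\times2$ traceless Hermitian matrices over $\mathbb{F}$. The Hopf map is $\Phi(v)=vv^*-\frac{\mathrm{tr}(vv^* )}{2}I_2$ for a column vector $v\in\mathbb{F}^2$, i.e. $$\Phi\begin{pmatrix}x\\ y\end{pmatrix}=\begin{pmatrix}\frac{|x|^2-|y|^2}{2}&x\overline{y}\\ y\overline{x}&\frac{|y|^2-|x|^2}{2}\end{pmatrix}.$$ $\mathbb{F}(1)=\{c\in\mathbb{F}:|c|=1\}$. *)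

(* Defs.v *)
From HB Require Import structures.
From mathcomp Require Import all_boot all_order all_algebra.
From mathcomp Require Import complex.
From mathcomp Require Import all_classical all_reals all_analysis.
From mathcomp Require Import ring lra.

Set Implicit Arguments.
Unset Strict Implicit.
Unset Printing Implicit Defensive.

Import Order.TTheory GRing.Theory Num.Theory.
Import numFieldNormedType.Exports.

Local Open Scope classical_set_scope.
Local Open Scope ring_scope.

(* A common interface for the real normed division algebras: a real algebra
   with a conjugation, a norm, and the topology of that norm.  Only the three
   instances below are used; see [scalars].  The norm is a field of this
   mixin, and not inherited from [normedModType R], because the library's
   hierarchy has no join of rings and normed groups below [numDomainType]. *)
HB.mixin Record TopologicalAlgebra_hasConjNorm (R : realType) F
    & GRing.Algebra R F & Topological F := {
  conjF : F -> F;
  normF : F -> R;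
  conjFD : forall x y : F, conjF (x + y) = conjF x + conjF y;
  conjFZ : forall (a : R) (x : F), conjF (a *: x) = a *: conjF x;
  conjFM : forall x y : F, conjF (x * y) = conjF y * conjF x;
  conjFK : forall x : F, conjF (conjF x) = x;
  normF_ge0 : forall x : F, 0 <= normF x;
  mulF_conj : forall x : F, x * conjF x = (normF x ^+ 2)%:A;
  nbhs_normFP : forall (x : F) (A : set F),
    nbhs x A <->
    exists2 e : R, 0 < e & forall y : F, normF (x - y) < e -> A y }.

#[short(type="normedStarAlgType")]
HB.structure Definition NormedStarAlgebra (R : realType) :=
  {F of GRing.Algebra R F & Topological F
      & TopologicalAlgebra_hasConjNorm R F}.

Arguments conjF {R F} : rename.
Arguments normF {R F} : rename.

Lemma nbhs_normedP (R : realType) (V : normedModType R) (x : V) (A : set V) :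
  nbhs x A <-> exists2 e : R, 0 < e & forall y : V, `|x - y| < e -> A y.
Proof. exact: (@nbhs_normP R V x A). Qed.

Section RealAlgebra.
Variable R : realType.

Let conjR (x : R^o) : R^o := x.

Let conjRM (x y : R^o) : conjR (x * y) = conjR y * conjR x.
Proof. by rewrite /conjR mulrC. Qed.

Let mulR_conj (x : R^o) : x * conjR x = (`|x| ^+ 2)%:A.
Proof. by rewrite /conjR real_normK ?num_real// expr2 [RHS]mulr1. Qed.

HB.instance Definition _ := TopologicalAlgebra_hasConjNorm.Build R R^o
  (fun _ _ => erefl) (fun _ _ => erefl) conjRM (fun _ => erefl)
  (@normr_ge0 R R^o) mulR_conj (@nbhs_normedP R R^o).

End RealAlgebra.

(* [Rcomplex R] is the library's copy of [R[i]] whose scalars, and whose norm's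
   values, are in [R] rather than in [R[i]]. *)
Section ComplexAlgebra.
Variable R : realType.
Local Notation C := (Rcomplex R).

Let scalecAr (a : R) (x y : C) : a *: (x * y) = x * (a *: y).
Proof.
case: x y => [x0 x1] [y0 y1].
by apply/eqP; rewrite eq_complex /=; apply/andP; split; apply/eqP; ring.
Qed.
HB.instance Definition _ := GRing.Lalgebra_isAlgebra.Build R C scalecAr.

Let normcZ (a : R) (x : C) : `|a *: x| = `|a| * `|x|.
Proof.
case: x => x0 x1.
rewrite -sqrtr_sqr -[LHS]/(Num.sqrt ((a * x0) ^+ 2 + (a * x1) ^+ 2)).
rewrite -[X in _ = _ * X]/(Num.sqrt (x0 ^+ 2 + x1 ^+ 2)) -sqrtrM ?sqr_ge0//.
by congr Num.sqrt; ring.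
Qed.
HB.instance Definition _ := isPointed.Build C 0.
HB.instance Definition _ := PseudoMetric.copy C (pseudoMetric_normed C).
HB.instance Definition _ :=
  NormedZmod_PseudoMetric_eq.Build R C erefl.
HB.instance Definition _ :=
  PseudoMetricNormedZmod_Lmodule_isNormedModule.Build R C normcZ.

Let conjC (x : C) : C := conjc x.

Let conjCD (x y : C) : conjC (x + y) = conjC x + conjC y.
Proof.
case: x y => [x0 x1] [y0 y1].
by apply/eqP; rewrite eq_complex /=; apply/andP; split; apply/eqP; ring.
Qed.

Let conjCZ (a : R) (x : C) : conjC (a *: x) = a *: conjC x.
Proof.
case: x => x0 x1.
by apply/eqP; rewrite eq_complex /=; apply/andP; split; apply/eqP; ring.
Qed.

Let conjCM (x y : C) : conjC (x * y) = conjC y * conjC x.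
Proof.
case: x y => [x0 x1] [y0 y1].
by apply/eqP; rewrite eq_complex /=; apply/andP; split; apply/eqP; ring.
Qed.

Let conjCK (x : C) : conjC (conjC x) = x.
Proof. by case: x => x0 x1; rewrite /conjC /= opprK. Qed.

Let mulC_conj (x : C) : x * conjC x = (`|x| ^+ 2)%:A.
Proof.
case: x => x0 x1.
rewrite -[`|_|]/(Num.sqrt (x0 ^+ 2 + x1 ^+ 2)) sqr_sqrtr ?addr_ge0 ?sqr_ge0//.
by apply/eqP; rewrite eq_complex /=; apply/andP; split; apply/eqP; ring.
Qed.

HB.instance Definition _ := TopologicalAlgebra_hasConjNorm.Build R C
  conjCD conjCZ conjCM conjCK (@normr_ge0 R C) mulC_conj (@nbhs_normedP R C).

End ComplexAlgebra.

(* [Quat a b c d] is a + b i + c j + d k. *)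
Record quaternion (R : Type) := Quat { qre : R; qi : R; qj : R; qk : R }.

Section QuaternionEqChoice.
Variable R : Type.

Definition tuple_of_quat (x : quaternion R) : R * R * R * R :=
  (qre x, qi x, qj x, qk x).
Definition quat_of_tuple (x : R * R * R * R) : quaternion R :=
  let: (a, b, c, d) := x in Quat a b c d.
Lemma tuple_of_quatK : cancel tuple_of_quat quat_of_tuple.
Proof. by case. Qed.
End QuaternionEqChoice.

HB.instance Definition _ (R : eqType) := Equality.copy (quaternion R)
  (can_type (@tuple_of_quatK R)).
HB.instance Definition _ (R : choiceType) := Choice.copy (quaternion R)
  (can_type (@tuple_of_quatK R)).

Section QuaternionAlgebra.
Variable R : realType.
Local Notation H := (quaternion R).

Definition quat_add (x y : H) : H :=
  Quat (qre x + qre y) (qi x + qi y) (qj x + qj y) (qk x + qk y).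
Definition quat_opp (x : H) : H := Quat (- qre x) (- qi x) (- qj x) (- qk x).
Definition quat_mul (x y : H) : H :=
  Quat (qre x * qre y - qi x * qi y - qj x * qj y - qk x * qk y)
       (qre x * qi y + qi x * qre y + qj x * qk y - qk x * qj y)
       (qre x * qj y - qi x * qk y + qj x * qre y + qk x * qi y)
       (qre x * qk y + qi x * qj y - qj x * qi y + qk x * qre y).
Definition quat_scale (a : R) (x : H) : H :=
  Quat (a * qre x) (a * qi x) (a * qj x) (a * qk x).
Definition quat_conj (x : H) : H := Quat (qre x) (- qi x) (- qj x) (- qk x).
Definition quat_norm (x : H) : R :=
  Num.sqrt (qre x ^+ 2 + qi x ^+ 2 + qj x ^+ 2 + qk x ^+ 2).

Let addqA : associative quat_add.
Proof. by case=> ? ? ? ? [? ? ? ?] [? ? ? ?]; congr Quat; exact: addrA. Qed.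
Let addqC : commutative quat_add.
Proof. by case=> ? ? ? ? [? ? ? ?]; congr Quat; exact: addrC. Qed.
Let add0q : left_id (Quat 0 0 0 0) quat_add.
Proof. by case=> *; congr Quat; exact: add0r. Qed.
Let addNq : left_inverse (Quat 0 0 0 0) quat_opp quat_add.
Proof. by case=> *; congr Quat; exact: addNr. Qed.
HB.instance Definition _ :=
  GRing.isZmodule.Build H addqA addqC add0q addNq.

Let mulqA : associative quat_mul.
Proof. by case=> ? ? ? ? [? ? ? ?] [? ? ? ?]; congr Quat => /=; ring. Qed.
Let mul1q : left_id (Quat 1 0 0 0) quat_mul.
Proof. by case=> *; congr Quat => /=; ring. Qed.
Let mulq1 : right_id (Quat 1 0 0 0) quat_mul.
Proof. by case=> *; congr Quat => /=; ring. Qed.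
Let mulqDl : left_distributive quat_mul quat_add.
Proof. by case=> ? ? ? ? [? ? ? ?] [? ? ? ?]; congr Quat => /=; ring. Qed.
Let mulqDr : right_distributive quat_mul quat_add.
Proof. by case=> ? ? ? ? [? ? ? ?] [? ? ? ?]; congr Quat => /=; ring. Qed.
Let oneq_neq0 : Quat 1 0 0 0 != Quat 0 0 0 0 :> H.
Proof. by apply/eqP => -[] /eqP; rewrite oner_eq0. Qed.
HB.instance Definition _ := GRing.Zmodule_isNzRing.Build H
  mulqA mul1q mulq1 mulqDl mulqDr oneq_neq0.

Let scaleqA a b x : quat_scale a (quat_scale b x) = quat_scale (a * b) x.
Proof. by case: x => *; congr Quat; exact: mulrA. Qed.
Let scale1q : left_id 1 quat_scale.
Proof. by case=> *; congr Quat; exact: mul1r. Qed.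
Let scaleqDr : right_distributive quat_scale +%R.
Proof. by move=> ? [? ? ? ?] [? ? ? ?]; congr Quat; exact: mulrDr. Qed.
Let scaleqDl x : {morph quat_scale^~ x : a b / a + b}.
Proof. by case: x => ? ? ? ? a b; congr Quat; exact: mulrDl. Qed.
HB.instance Definition _ := GRing.Zmodule_isLmodule.Build R H
  scaleqA scale1q scaleqDr scaleqDl.

Let scaleqAl (a : R) (x y : H) : a *: (x * y) = a *: x * y.
Proof. by case: x y => ? ? ? ? [? ? ? ?]; congr Quat => /=; ring. Qed.
HB.instance Definition _ := GRing.Lmodule_isLalgebra.Build R H scaleqAl.

Let scaleqAr (a : R) (x y : H) : a *: (x * y) = x * (a *: y).
Proof. by case: x y => ? ? ? ? [? ? ? ?]; congr Quat => /=; ring. Qed.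
HB.instance Definition _ := GRing.Lalgebra_isAlgebra.Build R H scaleqAr.

Let sqnorm_ge0 (x : H) :
  0 <= qre x ^+ 2 + qi x ^+ 2 + qj x ^+ 2 + qk x ^+ 2.
Proof. by rewrite !addr_ge0 ?sqr_ge0. Qed.

Let ler_normqD (x y : H) : quat_norm (x + y) <= quat_norm x + quat_norm y.
Proof.
rewrite -(@ler_pXn2r _ 2) ?nnegrE ?addr_ge0 ?sqrtr_ge0// sqrrD.
rewrite !sqr_sqrtr ?sqnorm_ge0//.
set t := qre x * qre y + qi x * qi y + qj x * qj y + qk x * qk y.
suff : t <= quat_norm x * quat_norm y.
  by rewrite /t -mulr_natr /=; move: (quat_norm x * quat_norm y) => u; lra.
rewrite (le_trans (ler_norm _))// -(@ler_pXn2r _ 2) ?nnegrE ?mulr_ge0 ?sqrtr_ge0//.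
rewrite exprMn !sqr_sqrtr ?sqnorm_ge0// real_normK ?num_real// -subr_ge0.
have -> : (qre x ^+ 2 + qi x ^+ 2 + qj x ^+ 2 + qk x ^+ 2) *
          (qre y ^+ 2 + qi y ^+ 2 + qj y ^+ 2 + qk y ^+ 2) - t ^+ 2 =
  (qre x * qi y - qi x * qre y) ^+ 2 + (qre x * qj y - qj x * qre y) ^+ 2 +
  (qre x * qk y - qk x * qre y) ^+ 2 + (qi x * qj y - qj x * qi y) ^+ 2 +
  (qi x * qk y - qk x * qi y) ^+ 2 + (qj x * qk y - qk x * qj y) ^+ 2.
  by rewrite /t; ring.
by rewrite !addr_ge0 ?sqr_ge0.
Qed.

Let normqZ (a : R) (x : H) : quat_norm (a *: x) = `|a| * quat_norm x.
Proof.
rewrite /quat_norm -(sqrtr_sqr a) -sqrtrM ?sqr_ge0//.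
by congr Num.sqrt; rewrite /=; ring.
Qed.

Let normq0_eq0 (x : H) : quat_norm x = 0 -> x = 0.
Proof.
move=> /eqP; rewrite sqrtr_eq0 => x0; case: x x0 => a b c d /= x0.
have p := (sqr_ge0 a, sqr_ge0 b, sqr_ge0 c, sqr_ge0 d).
have sq0 (z : R) : z ^+ 2 <= 0 -> z = 0.
  by move=> z0; apply/eqP; rewrite -sqrf_eq0 eq_le z0 sqr_ge0.
congr Quat; apply: sq0; move: p => [[[]]].
all: by move: (a ^+ 2) (b ^+ 2) (c ^+ 2) (d ^+ 2) x0 => *; lra.
Qed.

HB.instance Definition _ := isPointed.Build H 0.
HB.instance Definition _ :=
  Lmodule_isNormed.Build R H ler_normqD normqZ normq0_eq0.

Let conjqD (x y : H) : quat_conj (x + y) = quat_conj x + quat_conj y.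
Proof. by congr Quat => /=; ring. Qed.
Let conjqZ (a : R) (x : H) : quat_conj (a *: x) = a *: quat_conj x.
Proof. by congr Quat => /=; ring. Qed.
Let conjqM (x y : H) : quat_conj (x * y) = quat_conj y * quat_conj x.
Proof. by congr Quat => /=; ring. Qed.
Let conjqK (x : H) : quat_conj (quat_conj x) = x.
Proof. by case: x => *; congr Quat => /=; ring. Qed.
Let mulq_conj (x : H) : x * quat_conj x = (`|x| ^+ 2)%:A.
Proof.
rewrite -[`|x|]/(quat_norm x) sqr_sqrtr ?sqnorm_ge0//.
by congr Quat => /=; ring.
Qed.
HB.instance Definition _ := TopologicalAlgebra_hasConjNorm.Build R H
  conjqD conjqZ conjqM conjqK (@normr_ge0 R H) mulq_conj (@nbhs_normedP R H).

End QuaternionAlgebra.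

Inductive scalar_kind := Reals | Complexes | Quaternions.

Definition scalars (R : realType) (k : scalar_kind) : normedStarAlgType R :=
  match k with
  | Reals => R^o
  | Complexes => Rcomplex R
  | Quaternions => quaternion R
  end.

Definition adjmx (R : realType) (F : normedStarAlgType R) (m n : nat)
    (A : 'M[F]_(m, n)) : 'M[F]_(n, m) := map_mx conjF A^T.

Definition mx22 (F : Type) (a b c d : F) : 'M[F]_2 :=
  \matrix_(i < 2, j < 2)
    if i == 0 then if j == 0 then a else b else if j == 0 then c else d.

Definition herm0mx (R : realType) (F : normedStarAlgType R) : pred 'M[F]_2 :=
  fun A => (adjmx A == A) && (\tr A == 0).

Record herm0 (R : realType) (F : normedStarAlgType R) := Herm0 {
  herm0_val :> 'M[F]_2;
  herm0P : herm0mx herm0_val }.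

HB.instance Definition _ (R : realType) (F : normedStarAlgType R) :=
  [isSub for @herm0_val R F].
HB.instance Definition _ (R : realType) (F : normedStarAlgType R) :=
  [Choice of herm0 F by <:].

Section Herm0.
Variables (R : realType) (F : normedStarAlgType R).
Implicit Types x y : F.

Lemma conjF0 : conjF (0 : F) = 0.
Proof. by rewrite -(scale0r (0 : F)) conjFZ !scale0r. Qed.

Lemma conjFN x : conjF (- x) = - conjF x.
Proof. by rewrite -scaleN1r conjFZ scaleN1r. Qed.

Lemma conjF1 : conjF (1 : F) = 1.
Proof. by rewrite -[LHS]mul1r -{1}[1]conjFK -conjFM mul1r conjFK. Qed.

Lemma conjFA (a : R) : conjF (a%:A : F) = a%:A.
Proof. by rewrite conjFZ conjF1. Qed.

Lemma mx22_eta (A : 'M[F]_2) : A = mx22 (A 0 0) (A 0 1) (A 1 0) (A 1 1).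
Proof.
apply/matrixP => i j; rewrite mxE.
by case: (unliftP 0 i) => [i'|] ->; case: (unliftP 0 j) => [j'|] ->;
   rewrite ?ord1 //=; congr (A _ _); apply/val_inj.
Qed.

Lemma adjmx22 (a b c d : F) :
  adjmx (mx22 a b c d) = mx22 (conjF a) (conjF c) (conjF b) (conjF d).
Proof. by rewrite [LHS]mx22_eta !mxE. Qed.

Lemma mxtrace22 (a b c d : F) : \tr (mx22 a b c d) = a + d.
Proof. by rewrite /mxtrace big_ord_recl big_ord1 !mxE. Qed.

Fact herm0_zmod_closed : zmod_closed (@herm0mx R F).
Proof.
split.
  rewrite unfold_in /herm0mx mxtrace0 eqxx andbT.
  by apply/eqP/matrixP => i j; rewrite !mxE conjF0.
move=> A B; rewrite !unfold_in /herm0mx.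
move=> /andP[/eqP hA /eqP tA] /andP[/eqP hB /eqP tB].
rewrite raddfB /= tA tB subrr eqxx andbT; apply/eqP.
rewrite -{2}hA -{2}hB; apply/matrixP => i j.
by rewrite !mxE conjFD conjFN.
Qed.
HB.instance Definition _ :=
  GRing.isZmodClosed.Build 'M[F]_2 (@herm0mx R F) herm0_zmod_closed.
HB.instance Definition _ := [SubChoice_isSubZmodule of herm0 F by <:].

Fact scale_herm0_subproof (a : R) (A : herm0 F) :
  herm0mx (map_mx ( *:%R a) (\val A)).
Proof.
case: A => A /= /andP[/eqP hA /eqP tA]; apply/andP; split; apply/eqP.
  by rewrite -{2}hA; apply/matrixP => i j; rewrite !mxE conjFZ.
rewrite /mxtrace (eq_bigr (fun i => a *: A i i)) => [|i _]; last by rewrite mxE.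
by rewrite -scaler_sumr -/(\tr A) tA scaler0.
Qed.
Definition scale_herm0 (a : R) (A : herm0 F) : herm0 F :=
  Herm0 (scale_herm0_subproof a A).

Let scale_herm0A a b (A : herm0 F) :
  scale_herm0 a (scale_herm0 b A) = scale_herm0 (a * b) A.
Proof. by apply/val_inj/matrixP => i j; rewrite !mxE scalerA. Qed.
Let scale_herm01 : left_id 1 scale_herm0.
Proof. by move=> A; apply/val_inj/matrixP => i j; rewrite !mxE scale1r. Qed.
Let scale_herm0Dr : right_distributive scale_herm0 +%R.
Proof. by move=> a A B; apply/val_inj/matrixP => i j; rewrite !mxE scalerDr. Qed.
Let scale_herm0Dl A : {morph scale_herm0^~ A : a b / a + b}.
Proof. by move=> a b; apply/val_inj/matrixP => i j; rewrite !mxE scalerDl. Qed.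
(* Over [R], not [F]: Hermitian matrices are not stable by scaling in [F]. *)
HB.instance Definition _ := GRing.Zmodule_isLmodule.Build R (herm0 F)
  scale_herm0A scale_herm01 scale_herm0Dr scale_herm0Dl.

Fact mkherm0_subproof (lam : R) (alpha : F) :
  herm0mx (mx22 lam%:A alpha (conjF alpha) (- lam%:A)).
Proof.
by rewrite /herm0mx adjmx22 mxtrace22 conjFN conjFA conjFK subrr !eqxx.
Qed.
Definition mkherm0 (lam : R) (alpha : F) : herm0 F :=
  Herm0 (mkherm0_subproof lam alpha).

Definition hopf_mx (v : 'cV[F]_2) : 'M[F]_2 :=
  v *m adjmx v - (2^-1 *: \tr (v *m adjmx v))%:M.

Lemma hopf_mxE (v : 'cV[F]_2) : let x := v 0 0 in let y := v 1 0 in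
  hopf_mx v = mx22 ((normF x ^+ 2 - normF y ^+ 2) / 2)%:A (x * conjF y)
                   (y * conjF x) ((normF y ^+ 2 - normF x ^+ 2) / 2)%:A.
Proof.
move=> x y; rewrite /hopf_mx.
have -> : v *m adjmx v = mx22 (normF x ^+ 2)%:A (x * conjF y)
                              (y * conjF x) (normF y ^+ 2)%:A.
  by rewrite [LHS]mx22_eta !mxE !big_ord1 !mxE !mulF_conj.
rewrite mxtrace22 [LHS]mx22_eta !mxE /= !mulr1n !mulr0n !subr0.
by rewrite -scalerDl !scalerA -!scalerBl; congr mx22; congr (_ *: _); field.
Qed.

Fact hopf_subproof (v : 'cV[F]_2) : herm0mx (hopf_mx v).
Proof.
rewrite hopf_mxE /herm0mx adjmx22 mxtrace22 !conjFA !conjFM !conjFK eqxx /=.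
by rewrite -scalerDl -mulrDl addrA subrK subrr mul0r scale0r.
Qed.
Definition hopf (v : 'cV[F]_2) : herm0 F := Herm0 (hopf_subproof v).

Definition unit_scalars : set F := [set c | normF c = 1].

End Herm0.

Arguments unit_scalars {R} F.

Definition homeomorphic (X Y : topologicalType) : Prop :=
  exists (f : X -> Y) (g : Y -> X),
    [/\ cancel f g, cancel g f, continuous f & continuous g].

(* Main.v *)
(* All points of a nonzero fibre have the same Gram matrix [v v^*], because its
   trace |x|^2 + |y|^2 is determined by (|x|^2 - |y|^2)^2 + 4 |x conj(y)|^2.
   Hence the fibre through [w] is [{w c : |c| = 1}], and [c] is recovered from
   [v = w c] through any coordinate [w_i <> 0] as |w_i|^-2 conj(w_i) v_i. *)
Require Import Defs.
From mathcomp Require Import all_boot all_order all_algebra.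
From mathcomp Require Import complex.
From mathcomp Require Import all_classical all_reals all_analysis.
From mathcomp Require Import ring lra.
Import Order.TTheory GRing.Theory Num.Theory.

Local Open Scope classical_set_scope.
Local Open Scope ring_scope.

(** * Norm, conjugation and continuity in a normed star algebra *)

Section NormedStarAlgebra.
Context {R : realType} {F : normedStarAlgType R}.
Implicit Types (a b : R) (x y : F).

(** Lets real identities between squared norms be proved inside [F], where [mulF_conj] applies. *)
Lemma scalarA_inj : injective (fun a => a%:A : F).
Proof.
move=> a b /eqP; rewrite -subr_eq0 -scalerBl scaler_eq0 oner_eq0 orbF subr_eq0.
by move/eqP.
Qed.

Lemma normF_eq x y : normF x ^+ 2 = normF y ^+ 2 -> normF x = normF y.
Proof. by move/eqP; rewrite eqrXn2 ?normF_ge0// => /eqP. Qed.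

Lemma normF0 : normF (0 : F) = 0.
Proof.
apply/eqP; rewrite -sqrf_eq0; apply/eqP/scalarA_inj.
by rewrite /= -mulF_conj mul0r scale0r.
Qed.

Lemma normFM x y : normF (x * y) = normF x * normF y.
Proof.
apply/eqP; rewrite -(@eqrXn2 _ 2) ?mulr_ge0 ?normF_ge0//; apply/eqP.
apply: scalarA_inj; rewrite /= -mulF_conj conjFM -mulrA (mulrA y) mulF_conj.
by rewrite -scalerAl mul1r -scalerAr mulF_conj scalerA exprMn mulrC.
Qed.

(** Associativity gives [x * (conjF x * x) = (x * conjF x) * x]; the two sides are the real
    multiples of [x] by |conj(x)|^2 and |x|^2, and a nonzero [x] cancels. *)
Lemma normF_conj x : normF (conjF x) = normF x.
Proof.
have [->|x0] := eqVneq x 0; first by rewrite conjF0.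
apply/normF_eq/eqP.
suff : (normF (conjF x) ^+ 2 - normF x ^+ 2) *: x == 0.
  by rewrite scaler_eq0 (negbTE x0) orbF subr_eq0.
rewrite scalerBl subr_eq0 -[X in X == _]mulr1 -scalerAl scalerAr -mulF_conj.
by rewrite conjFK mulrA mulF_conj -scalerAl mul1r.
Qed.

Lemma conjF_mul x : conjF x * x = (normF x ^+ 2)%:A.
Proof. by rewrite -{2}[x]conjFK mulF_conj normF_conj. Qed.

Lemma sqr_normFA a : normF (a%:A : F) ^+ 2 = a ^+ 2.
Proof.
by apply: scalarA_inj; rewrite /= -mulF_conj conjFA -scalerAl mul1r scalerA -expr2.
Qed.

Lemma sqr_normFZ a x : normF (a *: x) ^+ 2 = a ^+ 2 * normF x ^+ 2.
Proof. by rewrite -[x in LHS]mul1r scalerAl normFM exprMn sqr_normFA. Qed.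

Lemma mulF_continuous x : continuous (fun y => x * y).
Proof.
move=> y A; rewrite nbhs_normFP => -[e e0 eA].
(* The [+ 1] keeps the denominator positive when [normF x = 0]. *)
apply/nbhs_normFP; exists (e / (normF x + 1)).
  by rewrite divr_gt0 // ltr_wpDl ?normF_ge0.
move=> z; have x1 : 0 < normF x + 1 by rewrite ltr_wpDl ?normF_ge0.
rewrite ltr_pdivlMr// => yz; apply: eA; rewrite -mulrBr normFM.
apply: le_lt_trans yz; rewrite mulrC ler_wpM2l ?normF_ge0//.
by rewrite lerDl.
Qed.

Lemma scaleF_continuous a : continuous (fun x => a *: x).
Proof.
rewrite (_ : (fun x => _) = (fun x => a%:A * x)).
  exact: mulF_continuous.
by apply/funext => x; rewrite -scalerAl mul1r.
Qed.

End NormedStarAlgebra.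

(** * Topology of matrices and of subspaces *)

Lemma mx_coord_continuous (T : topologicalType) m n (i : 'I_m) (j : 'I_n) :
  continuous (fun M : 'M[T]_(m, n) => M i j).
Proof.
move=> M A MA.
exists (fun i' j' => if (i' == i) && (j' == j) then A else setT).
  move=> i' j'; case: ifP => [/andP[/eqP-> /eqP->]//|_]; exact: filterT.
by move=> N /(_ i j) /=; rewrite !eqxx.
Qed.

Lemma mx_continuous (T U : topologicalType) m n (f : U -> 'M[T]_(m, n)) :
  (forall i j, continuous (fun u => f u i j)) -> continuous f.
Proof.
move=> fc u A [P uP PA]; suff : \forall v \near u, forall i j, P i j (f v i j).
  by apply: filterS => v; exact: PA.
apply: filter_forall => i; apply: filter_forall => j.
exact: fc.
Qed.

(** A [set_type] carries the initial topology of its inclusion, so continuity of the restricted maps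
    is tested after composing with [set_val]. *)
Lemma homeomorphic_set (X Y : topologicalType) (A : set X) (B : set Y)
    (f : X -> Y) (g : Y -> X) :
  continuous f -> continuous g ->
  (forall x, A x -> B (f x)) -> (forall y, B y -> A (g y)) ->
  {in A, cancel f g} -> {in B, cancel g f} ->
  homeomorphic (set_type A) (set_type B).
Proof.
move=> fc gc fAB gBA fK gK.
exists (fun a => SigSub (mem_set (fAB _ (set_valP a)))).
exists (fun b => SigSub (mem_set (gBA _ (set_valP b)))).
split.
- by move=> a; apply/val_inj/fK/valP.
- by move=> b; apply/val_inj/gK/valP.
- apply: continuous_comp_initial => a.
  apply: (@continuous_comp _ _ _ set_val f); last exact: fc.
  exact: initial_continuous.
- apply: continuous_comp_initial => b.
  apply: (@continuous_comp _ _ _ set_val g); last exact: gc.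
  exact: initial_continuous.
Qed.

(** * Fibres and surjectivity of the Hopf map *)

Section HopfFibres.
Context {R : realType} {F : normedStarAlgType R}.
Implicit Types (v w : 'cV[F]_2) (lam : R) (alpha : F).

Lemma mx22_inj (a b c d a' b' c' d' : F) :
  mx22 a b c d = mx22 a' b' c' d' -> [/\ a = a', b = b', c = c' & d = d'].
Proof.
move=> /matrixP E.
by split; [have := E 0 0|have := E 0 1|have := E 1 0|have := E 1 1]; rewrite !mxE.
Qed.

(** [hopf_mx] depends on [v] only through v v^*. Conversely, the off-diagonal entries of v v^*
    appear unchanged in [hopf v], and the diagonal ones follow from the sum and difference of |x|^2
    and |y|^2. *)
Lemma hopf_gram v w : hopf v = hopf w <->
  forall i j, v i 0 * conjF (v j 0) = w i 0 * conjF (w j 0).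
Proof.
split=> [|E]; last first.
  apply/val_inj; rewrite /= /hopf_mx.
  have -> // : v *m adjmx v = w *m adjmx w.
  by apply/matrixP => i j; rewrite !mxE !big_ord1 !mxE.
move/(congr1 val); rewrite /= !hopf_mxE => /mx22_inj[/scalarA_inj E Exy Eyx _].
have/(congr1 normF) := Exy; rewrite !normFM !normF_conj => Nxy.
have [Nx Ny] : normF (v 0 0) ^+ 2 = normF (w 0 0) ^+ 2 /\
               normF (v 1 0) ^+ 2 = normF (w 1 0) ^+ 2.
  have := (normF_ge0 (v 0 0), normF_ge0 (v 1 0),
           normF_ge0 (w 0 0), normF_ge0 (w 1 0)).
  move: (normF (v 0 0)) (normF (v 1 0)) (normF (w 0 0)) (normF (w 1 0)) E Nxy.
  move=> a b c d E Nxy [[[a0 b0] c0] d0].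
  have S : a ^+ 2 + b ^+ 2 = c ^+ 2 + d ^+ 2.
    apply/eqP; rewrite -(@eqrXn2 _ 2) ?addr_ge0 ?sqr_ge0//; apply/eqP.
    have -> : (a ^+ 2 + b ^+ 2) ^+ 2 =
      4 * ((a ^+ 2 - b ^+ 2) / 2) ^+ 2 + 4 * (a * b) ^+ 2 by field.
    by rewrite E Nxy; field.
  by split; move: E S; move: (a ^+ 2) (b ^+ 2) (c ^+ 2) (d ^+ 2) => *; lra.
have I2 (i : 'I_2) : i = 0 \/ i = 1.
  by case: i => -[|[|//]] ?; [left|right]; exact: val_inj.
move=> i j; case: (I2 i) => ->; case: (I2 j) => -> //.
- by rewrite !mulF_conj Nx.
- by rewrite !mulF_conj Ny.
Qed.

Lemma hopf_fibre_homeo w (i : 'I_2) : normF (w i 0) != 0 ->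
  homeomorphic (set_type (@hopf R F @^-1` [set hopf w]))
               (set_type (unit_scalars F)).
Proof.
move=> wi0; set n := normF (w i 0).
apply: (@homeomorphic_set 'cV[F]_2 F (@hopf R F @^-1` [set hopf w])
  (unit_scalars F) (fun v => n ^- 2 *: (conjF (w i 0) * v i 0))
  (fun c => \col_j (w j 0 * c))).
- move=> v; apply: (@continuous_comp _ _ _ (fun v : 'cV[F]_2 => v i 0)
    (fun x => n ^- 2 *: (conjF (w i 0) * x))).
    exact: mx_coord_continuous.
  apply: (@continuous_comp _ _ _ (fun x => conjF (w i 0) * x)
    (fun x => n ^- 2 *: x)).
    exact: mulF_continuous.
  exact: scaleF_continuous.
- apply: mx_continuous => j k.
  rewrite (_ : (fun c => _) = (fun c => w j 0 * c)); first exact: mulF_continuous.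
  by apply/funext => c; rewrite mxE.
- move=> v /hopf_gram/(_ i i); rewrite !mulF_conj => /scalarA_inj /normF_eq E.
  apply/eqP; rewrite -(@eqrXn2 _ 2) ?normF_ge0// sqr_normFZ normFM normF_conj E.
  by rewrite -/n; apply/eqP; field.
(* Since [c] multiplies on the right, c conj(c) = 1 appears in the middle and drops out, even
   without commutativity. *)
- move=> c c1; apply/hopf_gram => j k; rewrite !mxE conjFM mulrA -(mulrA (w j 0)).
  by rewrite mulF_conj c1 expr1n scale1r mulr1.
(* Equality of Gram matrices gives w_j conj(w_i) v_i = v_j conj(v_i) v_i = |v_i|^2 v_j, with |v_i| =
   |w_i| = [n]. *)
- move=> v /set_mem /hopf_gram E; apply/matrixP => j k; rewrite ord1 mxE.
  rewrite -scalerAr mulrA -E -mulrA conjF_mul -scalerAr mulr1 scalerA.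
  have /scalarA_inj -> : (normF (v i 0) ^+ 2)%:A = (n ^+ 2)%:A :> F.
    by rewrite -!mulF_conj.
  by rewrite mulVf ?scale1r// sqrf_eq0.
- move=> c _; rewrite mxE mulrA conjF_mul -scalerAl mul1r scalerA.
  by rewrite mulVf ?scale1r// sqrf_eq0.
Qed.

Hypothesis normF_eq0 : forall x : F, normF x = 0 -> x = 0.

(** A preimage must satisfy |x|^2 + |y|^2 = 2 [rho] and |x|^2 - |y|^2 = 2 [lam], hence |x|^2 =
    [rho + lam]. If this is positive, take [x] real and solve x conj(y) = [alpha] for [y]. *)
Lemma hopf_onto lam alpha : exists v, hopf v = mkherm0 lam alpha.
Proof.
have mk x y : ((normF x ^+ 2 - normF y ^+ 2) / 2) = lam -> x * conjF y = alpha ->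
    exists v, hopf v = mkherm0 lam alpha.
  move=> El Ea; exists (\col_j if j == 0 then x else y).
  apply/val_inj; rewrite /= hopf_mxE !mxE /= El Ea -Ea conjFM conjFK.
  by rewrite -El; congr mx22; rewrite -[RHS]scaleNr; congr (_ *: _); field.
pose rho := Num.sqrt (lam ^+ 2 + normF alpha ^+ 2).
have rho2 : rho ^+ 2 = lam ^+ 2 + normF alpha ^+ 2.
  by rewrite sqr_sqrtr// addr_ge0 ?sqr_ge0.
have rho_ge : `|lam| <= rho.
  by rewrite -sqrtr_sqr ler_wsqrtr// lerDl sqr_ge0.
have [s0|s0] := ltP 0 (rho + lam).
  pose s := Num.sqrt (rho + lam).
  have s2 : s ^+ 2 = rho + lam by rewrite sqr_sqrtr// ltW.
  have sn0 : s != 0 by rewrite gt_eqF// sqrtr_gt0.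
  apply: (mk s%:A (s^-1 *: conjF alpha)).
    rewrite sqr_normFA sqr_normFZ normF_conj exprVn s2.
    have -> : normF alpha ^+ 2 = rho ^+ 2 - lam ^+ 2 by rewrite rho2 addrC addKr.
    by field; rewrite gt_eqF.
  by rewrite conjFZ conjFK -scalerAl mul1r scalerA divff// scale1r.
(* Here [rho + lam <= 0] while [rho] is at least |lam|, so [rho = - lam]; this forces [alpha = 0]
   and leaves [x = 0] with |y|^2 = -2 [lam]. *)
have [lam0 rhoE] : lam <= 0 /\ rho = - lam.
  by move: rho_ge; rewrite ler_norml => /andP[? ?]; split; lra.
have alpha0 : alpha = 0.
  apply/normF_eq0/eqP; rewrite -sqrf_eq0; move: rho2; rewrite rhoE sqrrN.
  by rewrite -[LHS]addr0 => /addrI <-.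
apply: (mk 0 (Num.sqrt (- (2 * lam)))%:A); last by rewrite mul0r alpha0.
by rewrite normF0 sqr_normFA sqr_sqrtr; [field|lra].
Qed.

Lemma hopf0 : hopf (0 : 'cV[F]_2) = 0.
Proof.
apply/val_inj; rewrite /= /hopf_mx mul0mx mxtrace0 scaler0.
by apply/matrixP => i j; rewrite !mxE mul0rn subr0.
Qed.

(** The diagonal Gram entries |v_i|^2 agree with those of the zero vector. *)
Lemma hopf_eq0 v : hopf v = 0 -> v = 0.
Proof.
rewrite -hopf0 => /hopf_gram E; apply/matrixP => i j; rewrite ord1 mxE.
apply/normF_eq0/eqP; rewrite -sqrf_eq0; apply/eqP; apply: (@scalarA_inj R F).
by rewrite /= -mulF_conj E mxE mul0r scale0r.
Qed.

Lemma mkherm00 : mkherm0 0 (0 : F) = 0.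
Proof.
apply/val_inj => /=; rewrite [RHS]mx22_eta !mxE.
by rewrite scale0r oppr0 conjF0.
Qed.

Lemma mkherm0_eq0 lam alpha : mkherm0 lam alpha = 0 -> (lam, alpha) = (0, 0).
Proof.
rewrite -mkherm00 => /(congr1 val) /mx22_inj[/scalarA_inj-> -> _ _] //.
Qed.

Lemma hopf_fibre_unit lam alpha : (lam, alpha) <> (0, 0) ->
  homeomorphic (set_type (@hopf R F @^-1` [set mkherm0 lam alpha]))
               (set_type (unit_scalars F)).
Proof.
move=> n0; have [w hw] := hopf_onto lam alpha; rewrite -hw.
have [i wi] : exists i, normF (w i 0) != 0; last exact: hopf_fibre_homeo wi.
(* If all coordinates of [w] had norm zero, [w] would be 0 and [hopf w = 0] would give
   [(lam, alpha) = (0, 0)]. *)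
apply: contrapT => /forallNP w0; apply/n0/mkherm0_eq0; rewrite -hw -hopf0.
congr hopf; apply/matrixP => i j; rewrite ord1 mxE; apply: normF_eq0.
by apply: contrapT => /eqP; exact: w0.
Qed.

Hypothesis conjF_fixed : forall x : F, conjF x = x -> exists a : R, x = a%:A.

(** Diagonal entries of a Hermitian matrix are fixed by conjugation, hence real; trace zero makes
    them opposite. *)
Lemma herm0_mk (A : herm0 F) : exists lam alpha, A = mkherm0 lam alpha.
Proof.
have := herm0P A; rewrite /herm0mx [herm0_val A]mx22_eta adjmx22 mxtrace22.
move=> /andP[/eqP /mx22_inj[/conjF_fixed[lam El] _ Ealpha _]].
rewrite addrC addr_eq0 => /eqP Ed; exists lam, (A 0 1).
by apply/val_inj; rewrite /= [LHS]mx22_eta Ed -Ealpha El.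
Qed.

End HopfFibres.

(** * The three scalar algebras and the theorem *)

Lemma scalars_normF_eq0 (R : realType) k (x : scalars R k) :
  normF x = 0 -> x = 0.
Proof.
case: k x => x; first exact: (@normr0_eq0 R R^o).
- exact: (@normr0_eq0 R (Rcomplex R)).
- exact: (@normr0_eq0 R (quaternion R)).
Qed.

(** Conjugation negates each imaginary coordinate, so these vanish at a fixed point. *)
Lemma scalars_conjF_fixed (R : realType) k (x : scalars R k) :
  conjF x = x -> exists a : R, x = a%:A.
Proof.
have opp_fix (a : R) : - a = a -> a = 0.
  by move=> ?; lra.
case: k x => x.
- by exists x; rewrite /GRing.scale /= mulr1.
- case: x => a b [/opp_fix ->]; exists a.
  by apply/eqP; rewrite eq_complex /= mulr1 mulr0 !eqxx.
- case: x => a b c d [/opp_fix -> /opp_fix -> /opp_fix ->]; exists a.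
  by congr Quat => /=; rewrite ?mulr1 ?mulr0.
Qed.

Theorem lemma14 (R : realType) (k : scalar_kind) :
  let F := scalars R k in
  let Phi : 'cV[F]_2 -> herm0 F := @hopf R F in
  set_surj [set: 'cV[F]_2] [set: herm0 F] Phi /\
  forall (lam : R) (alpha : F),
    ((lam, alpha) <> (0, 0) ->
      homeomorphic (set_type (Phi @^-1` [set mkherm0 lam alpha]))
                   (set_type (unit_scalars F))) /\
    ((lam, alpha) = (0, 0) ->
      Phi @^-1` [set (0 : herm0 F)] = [set (0 : 'cV[F]_2)]).
Proof.
move=> F Phi; split=> [A _|lam alpha].
  have [lam [alpha ->]] := herm0_mk (@scalars_conjF_fixed R k) A.
  have [v <-] := hopf_onto (@scalars_normF_eq0 R k) lam alpha.
  by exists v.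
split=> [|_]; first exact: hopf_fibre_unit (@scalars_normF_eq0 R k) _ _.
apply/seteqP; split=> v /=; first exact: hopf_eq0 (@scalars_normF_eq0 R k) _.
by move=> ->; exact: hopf0.
Qed.
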